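(* Let $f:\mathbb{R}^n\to\mathbb{R}$ be twice differentiable and bounded below, with $f^*:=\inf_{x} f(x)>-\infty$, and suppose that $\|\nabla^2 f(x)-\nabla^2 f(y)\|\le M\|x-y\|$ for all $x,y\in\mathbb{R}^n$, where $M>0$. Let $\epsilon>0$. Then the universal trust-region method with the simple strategy, started at $x_0\in\mathbb{R}^n$, takes $$O\left(\sqrt{M}\,(f(x_0)-f^* )\,\epsilon^{-3/2}\log(G/\epsilon)\right)$$ iterations to find an $\epsilon$-approximate first-order stationary point, i.e. an iterate $x_k$ with $\|\nabla f(x_k)\|\le O(\epsilon)$. Here, with $\xi=\tfrac16$ and $\kappa=\tfrac1{81}$, $$G:=\max\left\{\frac1\xi\left(\frac{\sqrt M}{\kappa}(f(x_0)-f^* )\right)^{2/3},\ \|\nabla f(x_0)\|,\ \frac{12\sqrt M}{\sqrt\epsilon}(f(x_0)-f^* )\right\}.$$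
   Context: Norms are the Euclidean norm for vectors and the induced operator norm for matrices. The universal trust-region method with the simple strategy generates $x_{k+1}=x_k+d_k$, $k=0,1,2,\dots$, where $d_k$ is a (global) solution of $$\min_{d\in\mathbb{R}^n}\ \tfrac12 d^T\left(\nabla^2 f(x_k)+\sigma_k\|\nabla f(x_k)\|^{1/2}I\right)d+\nabla f(x_k)^Td\quad\text{s.t. }\|d\|\le r_k\|\nabla f(x_k)\|^{1/2},$$ with $(\sigma_k,r_k)=\left(\frac{\sqrt M}{3},\frac1{3\sqrt M}\right)$ for all $k$. The iteration bound is an asymptotic statement as $\epsilon\to0$ with an absolute implied constant; the $O(\epsilon)$ in the stationarity condition may be taken to be $\epsilon$ itself, i.e. the count is the index of the first iterate with $\|\nabla f(x_k)\|\le\epsilon$. *)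

(* Defs.v *)
From mathcomp Require Import all_boot all_order all_algebra.
From mathcomp Require Import all_classical all_reals all_analysis.
Set Implicit Arguments.
Unset Strict Implicit.
Unset Printing Implicit Defensive.
Import Order.TTheory GRing.Theory Num.Theory.
Import numFieldNormedType.Exports.
Local Open Scope classical_set_scope.
Local Open Scope ring_scope.

(* Points of R^n are row vectors. The library norm `|x| on 'rV[R]_n is the sup
   norm, so the Euclidean norm is introduced separately; differentiability does
   not depend on this choice. *)
Definition dotp (R : realType) (n : nat) (u v : 'rV[R]_n) : R :=
  (u *m v^T) 0 0.

Definition enorm (R : realType) (n : nat) (u : 'rV[R]_n) : R :=
  Num.sqrt (dotp u u).

(* A acts on row vectors by right multiplication; in the Euclidean case A and
   A^T have the same induced norm. *)
Definition opnorm (R : realType) (n : nat) (A : 'M[R]_n) : R :=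
  sup [set enorm (v *m A) | v in [set v : 'rV[R]_n | enorm v <= 1]].

Definition gradient (R : realType) (n : nat) (f : 'rV[R]_n -> R)
    (x : 'rV[R]_n) : 'rV[R]_n :=
  \row_i 'D_(delta_mx 0 i) f x.

Definition hessian (R : realType) (n : nat) (f : 'rV[R]_n -> R)
    (x : 'rV[R]_n) : 'M[R]_n :=
  jacobian (gradient f) x.

Definition twice_differentiable (R : realType) (n : nat)
    (f : 'rV[R]_n -> R) : Prop :=
  (forall x, differentiable f x) /\ (forall x, differentiable (gradient f) x).

Definition lipschitz_hessian (R : realType) (n : nat) (f : 'rV[R]_n -> R)
    (M : R) : Prop :=
  forall x y, opnorm (hessian f x - hessian f y) <= M * enorm (x - y).

Definition utr_model (R : realType) (n : nat) (f : 'rV[R]_n -> R) (sigma : R)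
    (x d : 'rV[R]_n) : R :=
  2^-1 * dotp (d *m (hessian f x
                     + (sigma * Num.sqrt (enorm (gradient f x)))%:M)) d
  + dotp (gradient f x) d.

Definition utr_feasible (R : realType) (n : nat) (f : 'rV[R]_n -> R) (r : R)
    (x d : 'rV[R]_n) : Prop :=
  enorm d <= r * Num.sqrt (enorm (gradient f x)).

Definition utr_solution (R : realType) (n : nat) (f : 'rV[R]_n -> R)
    (sigma r : R) (x d : 'rV[R]_n) : Prop :=
  utr_feasible f r x d /\
  forall d', utr_feasible f r x d' ->
    utr_model f sigma x d <= utr_model f sigma x d'.

Definition utr_iterates (R : realType) (n : nat) (f : 'rV[R]_n -> R)
    (sigma r : nat -> R) (x0 : 'rV[R]_n) (x : nat -> 'rV[R]_n) : Prop :=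
  x 0%N = x0 /\
  forall k, exists2 d, utr_solution f (sigma k) (r k) (x k) d
                     & x k.+1 = x k + d.

Definition utr_simple_iterates (R : realType) (n : nat) (f : 'rV[R]_n -> R)
    (M : R) (x0 : 'rV[R]_n) (x : nat -> 'rV[R]_n) : Prop :=
  utr_iterates f (fun=> Num.sqrt M / 3) (fun=> (3 * Num.sqrt M)^-1) x0 x.

(* k is the index of the first iterate that is eps-stationary, i.e. the number
   of iterations performed. *)
Definition first_stationary (R : realType) (n : nat) (f : 'rV[R]_n -> R)
    (x : nat -> 'rV[R]_n) (eps : R) (k : nat) : Prop :=
  enorm (gradient f (x k)) <= eps /\
  forall j, (j < k)%N -> eps < enorm (gradient f (x j)).

Definition init_gap (R : realType) (n : nat) (f : 'rV[R]_n -> R)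
    (x0 : 'rV[R]_n) : R :=
  f x0 - inf (range f).

Definition utr_xi (R : realType) : R := 6^-1.
Definition utr_kappa (R : realType) : R := 81^-1.

Definition utr_G (R : realType) (n : nat) (f : 'rV[R]_n -> R) (M : R)
    (x0 : 'rV[R]_n) (eps : R) : R :=
  Num.max
    ((utr_xi R)^-1 * (Num.sqrt M / utr_kappa R * init_gap f x0) `^ (2 / 3))
    (Num.max
      (enorm (gradient f x0))
      (12 * Num.sqrt M / Num.sqrt eps * init_gap f x0)).

(* Main.v *)
Require Import Defs.
From mathcomp Require Import all_boot all_order all_algebra.
From mathcomp Require Import all_classical all_reals all_analysis.
From mathcomp Require Import ring lra.
Import Order.TTheory GRing.Theory Num.Theory.
Import numFieldNormedType.Exports.
Local Open Scope classical_set_scope.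
Local Open Scope ring_scope.

(** Write g_k for the norm of the gradient at the k-th iterate, D for the
initial gap f x0 - inf f, and w for the gradient at x_k of the regularized
model after the step d_k.

One step (utr_step).  The radius and the regularization are balanced so that
the regularization term of the model dominates the cubic Taylor remainder: f
never increases, and the decrease is at least minus the model value plus
sqrt M * sqrt g_k * |d_k|^2 / 9.  If d_k is interior then w = 0 and Taylor's
formula for the gradient yields g_(k+1) <= g_k / 6.  If d_k lies on the
boundary then |d_k| = sqrt g_k / (3 sqrt M), so f decreases by at least
g_k^(3/2) / (81 sqrt M).  The gradient may then grow, but only in a controlled
way: minimality over the ball bounds radius * |w| by twice the model decrease
(ball_quadratic_minimizer), whence g_(k+1) <= g_k / 6 + O(sqrt M D / sqrt g_k).
No multiplier is introduced: the variational inequality for a minimizer over a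
convex set is enough.

All steps (potential_ge, first_index_le).  The quantity G bounds g_k at every
index before the first eps-stationary one.  With L = ln (G / eps), let N_k be
the decrease f x0 - f x_k measured in units of eps^(3/2) / (81 sqrt M), a lower
bound for the decrease in a boundary step with g_k > eps.  The potential

  N_k * (L + 1) + ln (G / g_k)

grows by at least 1 per step: an interior step divides g_k by 6 > e; a boundary
step adds at least 1 to N_k, and its loss in the logarithm is at most L.
As N_k <= 81 P with P = sqrt M * D * eps^(-3/2), at most 81 P (L + 1) + L
indices pass before stationarity.  For small eps both P and L are at least 1,
and the count is at most 164 P L.  When D = 0 the starting point is a global
minimizer and already stationary. *)

(** * Euclidean geometry of row vectors *)

Section Euclid.
Context {R : realType} {n : nat}.
Implicit Types (u v w : 'rV[R]_n) (A : 'M[R]_n) (a : R).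

Lemma dotpE u v : dotp u v = \sum_i u 0 i * v 0 i.
Proof. by rewrite /dotp mxE; apply: eq_bigr => i _; rewrite mxE. Qed.

Lemma dotpC u v : dotp u v = dotp v u.
Proof. by rewrite !dotpE; apply: eq_bigr => i _; rewrite mulrC. Qed.

Lemma dotpDl u v w : dotp (u + v) w = dotp u w + dotp v w.
Proof. by rewrite /dotp mulmxDl mxE. Qed.

Lemma dotpDr u v w : dotp w (u + v) = dotp w u + dotp w v.
Proof. by rewrite ![dotp w _]dotpC dotpDl. Qed.

Lemma dotpZl a u v : dotp (a *: u) v = a * dotp u v.
Proof. by rewrite /dotp -scalemxAl mxE. Qed.

Lemma dotpZr a u v : dotp u (a *: v) = a * dotp u v.
Proof. by rewrite ![dotp u _]dotpC dotpZl. Qed.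

Lemma dotpNl u v : dotp (- u) v = - dotp u v.
Proof. by rewrite -scaleN1r dotpZl mulN1r. Qed.

Lemma dotpNr u v : dotp u (- v) = - dotp u v.
Proof. by rewrite -scaleN1r dotpZr mulN1r. Qed.

Lemma dotp0l u : dotp 0 u = 0.
Proof. by rewrite /dotp mul0mx mxE. Qed.

Definition dotp_bilin := (dotpDl, dotpDr, dotpZl, dotpZr, dotpNl, dotpNr).

Lemma dotp_ge0 u : 0 <= dotp u u.
Proof. by rewrite dotpE sumr_ge0// => i _; rewrite -expr2 sqr_ge0. Qed.

Lemma dotp_eq0 u : (dotp u u == 0) = (u == 0).
Proof.
apply/idP/eqP => [|->]; last by rewrite dotp0l.
rewrite dotpE psumr_eq0 => [/allP u0|i _]; last by rewrite -expr2 sqr_ge0.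
apply/rowP => i; rewrite mxE; apply/eqP.
by have := u0 i; rewrite mem_index_enum mulf_eq0 orbb => /(_ isT).
Qed.

Lemma enorm_ge0 u : 0 <= enorm u.
Proof. exact: sqrtr_ge0. Qed.

Lemma sqr_enorm u : enorm u ^+ 2 = dotp u u.
Proof. by rewrite sqr_sqrtr ?dotp_ge0. Qed.

Lemma enorm_eq0 u : (enorm u == 0) = (u == 0).
Proof. by rewrite -dotp_eq0 -sqr_enorm expf_eq0. Qed.

Lemma enorm0 : enorm (0 : 'rV[R]_n) = 0.
Proof. by apply/eqP; rewrite enorm_eq0. Qed.

Lemma enormZ a u : enorm (a *: u) = `|a| * enorm u.
Proof.
by rewrite /enorm dotpZl dotpZr mulrA -expr2 sqrtrM ?sqr_ge0 // sqrtr_sqr.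
Qed.

Lemma enormN u : enorm (- u) = enorm u.
Proof. by rewrite -scaleN1r enormZ normrN1 mul1r. Qed.

(** Cauchy-Schwarz: the squared norm of |v|^2 u - <u,v> v, which is |v|^2 times
the defect of the inequality, is nonnegative. *)
Lemma sqr_dotp_le u v : dotp u v ^+ 2 <= dotp u u * dotp v v.
Proof.
have [->|v0] := eqVneq v 0.
  by rewrite dotpC !dotp0l mulr0 expr2 mulr0.
have vv : 0 < dotp v v by rewrite lt0r dotp_eq0 v0 dotp_ge0.
have := dotp_ge0 (dotp v v *: u - dotp u v *: v).
rewrite !dotp_bilin (dotpC v u) => H.
by rewrite -subr_ge0 -(pmulr_rge0 _ vv); apply: le_trans H _; lra.
Qed.

Lemma dotp_le u v : dotp u v <= enorm u * enorm v.
Proof.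
apply: le_trans (ler_norm _) _.
rewrite -(@ler_pXn2r _ 2) ?nnegrE ?mulr_ge0 ?enorm_ge0//.
by rewrite exprMn !sqr_enorm -normrX ger0_norm ?sqr_ge0 // sqr_dotp_le.
Qed.

Lemma enorm_triangle u v : enorm (u + v) <= enorm u + enorm v.
Proof.
rewrite -(@ler_pXn2r _ 2) ?nnegrE ?addr_ge0 ?enorm_ge0//.
rewrite sqrrD !sqr_enorm !dotp_bilin (dotpC v u).
have := dotp_le u v; lra.
Qed.

(** Turns scalar estimates, tested against an arbitrary direction, into norm
estimates for vectors. *)
Lemma enorm_le_dual u a : 0 <= a -> (forall v, dotp u v <= a * enorm v) ->
  enorm u <= a.
Proof.
move=> a0 /(_ u); rewrite -sqr_enorm expr2.
have [->//|u0] := eqVneq (enorm u) 0.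
by rewrite ler_pM2r// lt0r u0 enorm_ge0.
Qed.

(** The Frobenius norm dominates: Cauchy-Schwarz column by column.  This serves
to show that the supremum defining opnorm is over a bounded set. *)
Lemma enorm_mulmx_le A v : enorm (v *m A) <=
  enorm v * Num.sqrt (\sum_j dotp (col j A)^T (col j A)^T).
Proof.
rewrite -sqrtrM ?dotp_ge0// ler_sqrt; last first.
  by rewrite mulr_ge0 ?dotp_ge0// sumr_ge0// => j _; exact: dotp_ge0.
rewrite dotpE mulr_sumr ler_sum// => j _.
suff -> : (v *m A) 0 j = dotp v (col j A)^T by rewrite -expr2 sqr_dotp_le.
by rewrite mxE dotpE; apply: eq_bigr => i _; rewrite !mxE.
Qed.

Lemma enorm_mulmx_opnorm A v : enorm (v *m A) <= opnorm A * enorm v.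
Proof.
have [->|v0] := eqVneq v 0; first by rewrite mul0mx !enorm0 mulr0.
have vv : 0 < enorm v by rewrite lt0r enorm_eq0 v0 enorm_ge0.
rewrite -ler_pdivrMr//.
suff -> : enorm (v *m A) / enorm v = enorm (((enorm v)^-1 *: v) *m A).
  apply: ub_le_sup; last first.
    exists ((enorm v)^-1 *: v) => //=.
    by rewrite enormZ ger0_norm ?invr_ge0 ?enorm_ge0// mulVf ?gt_eqF.
  exists (Num.sqrt (\sum_j dotp (col j A)^T (col j A)^T)) => _ [w /= w1 <-].
  by rewrite (le_trans (enorm_mulmx_le _ _))// ler_piMl// sqrtr_ge0.
by rewrite -scalemxAl enormZ ger0_norm ?invr_ge0 ?enorm_ge0// mulrC.
Qed.
End Euclid.

(** * Taylor estimates with a Lipschitz Hessian *)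

(** First-order information from inequalities with an error of higher order:
divide by t and let t tend to 0. *)
Lemma le0_of_le_scaled {R : realType} (a b : R) :
  (forall t : R, 0 < t <= 1 -> a <= t * b) -> a <= 0.
Proof.
move=> H; rewrite leNgt; apply/negP => a0.
have b0 : 0 < b by have := H 1; rewrite ltr01 lexx mul1r => /(_ isT); lra.
have ab : a <= b by have := H 1; rewrite ltr01 lexx mul1r => /(_ isT).
(* At this t the right-hand side is a / 2. *)
have := H (a / (2 * b)); rewrite divr_gt0// ?mulr_gt0//=.
rewrite ler_pdivrMr ?mulr_gt0// mul1r.
have -> : a / (2 * b) * b = a / 2 by rewrite invfM mulrA mulfVK ?gt_eqF.
by move=> /(_ ltac:(lra)); lra.
Qed.

(** Integration over [0, 1] of a quadratic bound on the derivative, done by the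
mean value theorem applied to F minus the primitive of the bound. *)
Lemma taylor_le {R : realType} (F dF : R -> R) (a b c : R) :
  (forall t : R, is_derive t 1 F (dF t)) ->
  (forall t : R, 0 <= t <= 1 -> dF t <= a + b * t + c * t ^+ 2) ->
  F 1 <= F 0 + a + b / 2 + c / 3.
Proof.
move=> Fd dFle.
pose P : {poly R} := a *: 'X + (b / 2) *: 'X^2 + (c / 3) *: 'X^3.
have PE t : P.[t] = a * t + b / 2 * t ^+ 2 + c / 3 * t ^+ 3.
  by rewrite !hornerE.
have dPE t : (deriv P).[t] = a + b * t + c * t ^+ 2.
  by rewrite /P !poly.derivE !hornerE /=; field.
have Gd (t : R) : is_derive t 1 (F - horner P) (dF t - (deriv P).[t]).
  exact: is_deriveB.
have [|t t01] :=
  @MVT_segment R (F - horner P) (fun t => dF t - (deriv P).[t]) 0 1 ler01.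
  apply: continuous_subspaceT => t.
  apply: differentiable_continuous; apply/derivable1_diffP.
  exact: ex_derive.
rewrite subr0 mulr1 => E.
have := dFle t; rewrite in_itv/= in t01; move=> /(_ t01).
move: E; rewrite !fctE !PE !dPE; lra.
Qed.

Section Taylor.
Context {R : realType} {n : nat} (f : 'rV[R]_n -> R) (M : R).
Context (f2 : twice_differentiable f) (fM : lipschitz_hessian f M).
Implicit Types x y d u v w : 'rV[R]_n.

Lemma is_derive_line {W : normedModType R} (g : 'rV[R]_n -> W) x d (t : R) :
  differentiable g (x + t *: d) ->
  is_derive t 1 (fun s : R => g (x + s *: d)) ('D_d g (x + t *: d)).
Proof.
move=> gd; have gD := diff_derivable (v := d) gd.
have E : (fun h : R => h^-1 *: (((fun s : R => g (x + s *: d)) \o shift t) (h *: 1)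
             - g (x + t *: d))) =
         (fun h : R => h^-1 *: ((g \o shift (x + t *: d)) (h *: d)
             - g (x + t *: d))).
  apply/funext => h /=; congr (_ *: (g _ - _)).
  by rewrite scalerDl addrCA /GRing.scale/= mulr1.
by split; rewrite /derivable /derive E.
Qed.

Lemma derive_dotp_gradient x d : 'D_d f x = dotp (gradient f x) d.
Proof.
rewrite deriveE; last exact: f2.1.
rewrite {1}(row_sum_delta d) linear_sum dotpE; apply: eq_bigr => i _.
rewrite linearZ mxE deriveE; last exact: f2.1.
exact: mulrC.
Qed.

Lemma is_derive_f_line x d (t : R) :
  is_derive t 1 (fun s : R => f (x + s *: d)) (dotp (gradient f (x + t *: d)) d).
Proof. by rewrite -derive_dotp_gradient; apply: is_derive_line; exact: f2.1. Qed.

Lemma is_derive_gradient_line x d u (t : R) :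
  is_derive t 1 (fun s : R => dotp (gradient f (x + s *: d)) u)
    (dotp (d *m hessian f (x + t *: d)) u).
Proof.
(* The scalar product is a linear combination of coordinates, and a matrix-valued
   function is derived coordinate by coordinate. *)
have H := is_derive_line (gradient f) x d t (f2.2 (x + t *: d)).
have [D1 D2] := H.
have -> : (fun s : R => dotp (gradient f (x + s *: d)) u) =
   \sum_i (u 0 i \*: (fun s : R => (gradient f (x + s *: d)) 0 i)).
  by apply/funext => s; rewrite dotpE fct_sumE; apply: eq_bigr => i _; rewrite mulrC.
have -> : dotp (d *m hessian f (x + t *: d)) u =
   \sum_i u 0 i *: (d *m hessian f (x + t *: d)) 0 i.
  by rewrite dotpE; apply: eq_bigr => i _; rewrite mulrC.
apply: is_derive_sum => i.
apply: is_deriveZ.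
have D3 := (derivable_mxP _ _ _).1 D1 0 i.
apply: DeriveDef; first exact: D3.
rewrite -deriveEjacobian; last exact: f2.2.
apply: etrans (congr1 (fun A : 'rV[R]_n => A 0 i) D2).
have D4 := derive_mx D1.
by apply: etrans (esym (congr1 (fun A : 'rV[R]_n => A 0 i) D4)); rewrite mxE.
Qed.


Lemma dotp_hessian_lip x y v w :
  dotp (v *m hessian f x) w <=
    dotp (v *m hessian f y) w + M * enorm (x - y) * enorm v * enorm w.
Proof.
rewrite -lerBlDl -dotpNl -dotpDl -mulmxBr.
apply: le_trans (dotp_le _ _) _; rewrite ler_wpM2r ?enorm_ge0//.
by apply: le_trans (enorm_mulmx_opnorm _ _) _; rewrite ler_wpM2r ?enorm_ge0.
Qed.

Lemma dotp_gradient_taylor x d u :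
  dotp (gradient f (x + d)) u <=
    dotp (gradient f x) u + dotp (d *m hessian f x) u
    + M / 2 * enorm d ^+ 2 * enorm u.
Proof.
have := @taylor_le R (fun s => dotp (gradient f (x + s *: d)) u) _
  (dotp (d *m hessian f x) u) (M * enorm d ^+ 2 * enorm u) 0
  (is_derive_gradient_line x d u).
rewrite scale1r scale0r addr0 mul0r addr0 => H.
suff /H : forall t : R, 0 <= t <= 1 -> dotp (d *m hessian f (x + t *: d)) u <=
   dotp (d *m hessian f x) u + M * enorm d ^+ 2 * enorm u * t + 0 * t ^+ 2 by lra.
move=> t /andP[t0 t1]; apply: le_trans (dotp_hessian_lip _ x _ _) _.
by rewrite [x + _]addrC addrK enormZ ger0_norm//; lra.
Qed.

Lemma enorm_gradient_taylor x d : 0 <= M ->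
  enorm (gradient f (x + d) - gradient f x - d *m hessian f x)
    <= M / 2 * enorm d ^+ 2.
Proof.
move=> M0; apply: enorm_le_dual => [|v].
  by rewrite mulr_ge0 ?sqr_ge0//; lra.
by have := dotp_gradient_taylor x d v; rewrite !dotp_bilin; lra.
Qed.

Lemma taylor_upper x d :
  f (x + d) <= f x + dotp (gradient f x) d + 2^-1 * dotp (d *m hessian f x) d
               + M / 6 * enorm d ^+ 3.
Proof.
have := @taylor_le R (fun s => f (x + s *: d)) _
  (dotp (gradient f x) d) (dotp (d *m hessian f x) d) (M / 2 * enorm d ^+ 3)
  (is_derive_f_line x d).
rewrite scale1r scale0r addr0 => H.
suff /H : forall t : R, 0 <= t <= 1 -> dotp (gradient f (x + t *: d)) d <=
   dotp (gradient f x) d + dotp (d *m hessian f x) d * t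
   + M / 2 * enorm d ^+ 3 * t ^+ 2 by lra.
move=> t /andP[t0 t1]; apply: le_trans (dotp_gradient_taylor _ _ _) _.
by rewrite enormZ ger0_norm// -scalemxAl !dotp_bilin; lra.
Qed.

Lemma taylor_lower x d :
  f x + dotp (gradient f x) d + 2^-1 * dotp (d *m hessian f x) d
    <= f (x + d) + M / 6 * enorm d ^+ 3.
Proof.
have := @taylor_le R (- (fun s : R => f (x + s *: d))) _
  (- dotp (gradient f x) d) (- dotp (d *m hessian f x) d) (M / 2 * enorm d ^+ 3)
  (fun t => is_deriveN (is_derive_f_line x d t)).
rewrite !fctE scale1r scale0r addr0 => H.
suff /H : forall t : R, 0 <= t <= 1 -> - dotp (gradient f (x + t *: d)) d <=
   - dotp (gradient f x) d + - dotp (d *m hessian f x) d * t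
   + M / 2 * enorm d ^+ 3 * t ^+ 2 by lra.
move=> t /andP[t0 t1]; rewrite -dotpNr.
apply: le_trans (dotp_gradient_taylor _ _ _) _.
by rewrite enormZ enormN ger0_norm// -scalemxAl !dotp_bilin; lra.
Qed.

(** The increment of f over v + u is expanded in one go, and over v followed by
u; the second-order terms of the two expansions differ by half the left-hand
side, which is therefore bounded by the cubic remainders. *)
Lemma hessian_asym_le x u v :
  dotp (u *m hessian f x) v - dotp (v *m hessian f x) u <=
    M * (enorm u * enorm v ^+ 2 + enorm u ^+ 2 * enorm v
         + (enorm u ^+ 3 + enorm v ^+ 3 + enorm (u + v) ^+ 3) / 3).
Proof.
have H1 := taylor_lower x (v + u).
have H2 := taylor_upper (x + v) u.
have H3 := taylor_upper x v.
have H4 := dotp_gradient_taylor x v u.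
have H5 := dotp_hessian_lip (x + v) x u u.
move: H1 H2 H3 H4 H5; rewrite addrA [x + v - x]addrC addKr [v + u]addrC.
rewrite mulmxDl !(dotpDr u v) !(dotpDl (u *m _)).
(* Only linear arithmetic remains; abstracting the point values keeps the tactic
   from comparing Hessians and gradients at different points by unfolding. *)
move: (hessian f (x + v)) (hessian f x) (gradient f (x + v)) (gradient f x).
move: (f (x + v + u)) (f (x + v)).
by move=> *; lra.
Qed.

(** Rescale u and v by h: the asymmetry is of order h^2 but bounded by a multiple
of h^3. *)
Lemma hessian_sym x u v :
  dotp (u *m hessian f x) v = dotp (v *m hessian f x) u.
Proof.
suff K a b : dotp (a *m hessian f x) b <= dotp (b *m hessian f x) a.
  by apply/eqP; rewrite eq_le !K.
pose C := M * (enorm a * enorm b ^+ 2 + enorm a ^+ 2 * enorm b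
  + (enorm a ^+ 3 + enorm b ^+ 3 + enorm (a + b) ^+ 3) / 3).
rewrite -subr_le0; apply: (@le0_of_le_scaled _ _ C) => h /andP[h0 _].
have := hessian_asym_le x (h *: a) (h *: b).
rewrite -scalerDr !enormZ (ger0_norm (ltW h0)) -!scalemxAl !dotp_bilin => K.
have h2 : 0 < h ^+ 2 by rewrite exprn_gt0.
by rewrite -(ler_pM2l h2) /C; lra.
Qed.
End Taylor.

(** * One trust-region step *)

Section Ball.
Context {R : realType} {n : nat}.

(** With w the gradient of q at d, minimality over a convex set says that
<w, v - d> >= 0 for v in the ball; v = - rho w / |w| gives
rho |w| <= - <w, d> = - 2 q d + <g, d>.  Comparing d with - d shows
<g, d> <= 0.  When d is interior, Cauchy-Schwarz makes the first bound
absurd unless w = 0. *)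
Lemma ball_quadratic_minimizer (A : 'M[R]_n) (g d : 'rV[R]_n) (rho : R) :
  let q v := 2^-1 * dotp (v *m A) v + dotp g v in
  (forall u v, dotp (u *m A) v = dotp (v *m A) u) ->
  0 <= rho -> enorm d <= rho ->
  (forall v, enorm v <= rho -> q d <= q v) ->
  rho * enorm (g + d *m A) <= - 2 * q d /\
  (enorm d < rho -> g + d *m A = 0).
Proof.
move=> q symA rho0 drho dmin.
set w := g + d *m A.
have dir e : enorm (d + e) <= rho -> 0 <= dotp w e.
  move=> erho; rewrite -oppr_le0.
  apply: (@le0_of_le_scaled _ _ (2^-1 * dotp (e *m A) e)) => t /andP[t0 t1].
  have trho : enorm (d + t *: e) <= rho.
    have -> : d + t *: e = (1 - t) *: d + t *: (d + e).
      by rewrite scalerDr scalerBl scale1r addrA subrK.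
    apply: le_trans (enorm_triangle _ _) _; rewrite !enormZ !ger0_norm; [|lra..].
    nra.
  have := dmin _ trho.
  rewrite /q mulmxDl -scalemxAl !dotp_bilin (symA e d) => qt.
  by rewrite -(ler_pM2l t0); lra.
have wd : rho * enorm w <= - dotp w d.
  have [->|w0] := eqVneq w 0; first by rewrite enorm0 mulr0 dotp0l oppr0.
  have w1 : 0 < enorm w by rewrite lt0r enorm_eq0 w0 enorm_ge0.
  have cw : rho / enorm w * enorm w = rho by rewrite divfK ?gt_eqF.
  have c0 : 0 <= rho / enorm w by rewrite divr_ge0// ltW.
  have := dir (- (rho / enorm w *: w) - d).
  rewrite addrC subrK enormN enormZ (ger0_norm c0) cw => /(_ (lexx _)).
  by rewrite dotpDr !dotpNr dotpZr -sqr_enorm expr2 mulrA cw; lra.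
split.
  apply: le_trans wd _.
  have := dmin (- d); rewrite enormN => /(_ drho).
  rewrite /q /w mulNmx !dotp_bilin; lra.
move=> dlt; apply/eqP; rewrite -/w -enorm_eq0 eq_le enorm_ge0 andbT.
have := dotp_le w (- d); rewrite dotpNr enormN => wd2.
have : (rho - enorm d) * enorm w <= 0 by lra.
by rewrite pmulr_rle0// subr_gt0.
Qed.
End Ball.

Section Step.
Context {R : realType} {n : nat} (f : 'rV[R]_n -> R) (M : R).
Context (f2 : twice_differentiable f) (fM : lipschitz_hessian f M) (M0 : 0 < M).

(** The first alternative covers interior steps, the second boundary steps; the
last inequality is multiplied by sqrt g to avoid dividing by a possibly zero
gradient norm. *)
Lemma utr_step x d :
  utr_solution f (Num.sqrt M / 3) ((3 * Num.sqrt M)^-1) x d ->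
  let g := enorm (gradient f x) in
  let g' := enorm (gradient f (x + d)) in
  f (x + d) <= f x /\
  (g' <= g / 6 \/
   g * Num.sqrt g <= 81 * Num.sqrt M * (f x - f (x + d)) /\
   Num.sqrt g * g' <= Num.sqrt g * (g / 6) + 6 * Num.sqrt M * (f x - f (x + d))).
Proof.
move=> [dfeas dmin] g g'; rewrite /utr_feasible -/g in dfeas dmin.
set m := Num.sqrt M in dfeas dmin *.
set s := Num.sqrt g in dfeas dmin *.
have m0 : 0 < m by rewrite sqrtr_gt0.
have mM : M = m ^+ 2 by rewrite sqr_sqrtr// ltW.
have s0 : 0 <= s by exact: sqrtr_ge0.
have sg : g = s ^+ 2 by rewrite sqr_sqrtr// enorm_ge0.
pose A := hessian f x + (m / 3 * s)%:M.
have AE u v : dotp (u *m A) v = dotp (u *m hessian f x) v + m / 3 * s * dotp u v.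
  by rewrite /A mulmxDr mul_mx_scalar !dotp_bilin.
have symA u v : dotp (u *m A) v = dotp (v *m A) u.
  by rewrite !AE (hessian_sym _ _ f2 fM) (dotpC u).
have rho0 : 0 <= (3 * m)^-1 * s by rewrite mulr_ge0// invr_ge0; lra.
have [wq wint] := ball_quadratic_minimizer _ _ _ _ symA rho0 dfeas dmin.
set w := gradient f x + d *m A in wq wint.
have q0 : 2^-1 * dotp (d *m A) d + dotp (gradient f x) d <= 0.
  have := dmin 0; rewrite enorm0 => /(_ rho0).
  by rewrite /utr_model -/A mul0mx !(dotpC _ 0) !dotp0l; lra.
have wE : gradient f x + d *m hessian f x = w - (m / 3 * s) *: d.
  by rewrite /w /A mulmxDr mul_mx_scalar addrA addrK.
have T := taylor_upper f M f2 fM x d.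
have gT := enorm_gradient_taylor f M f2 fM x d (ltW M0).
have g'E : gradient f (x + d) =
    (gradient f (x + d) - gradient f x - d *m hessian f x) + (w - (m / 3 * s) *: d).
  by rewrite -wE -(addrA (gradient f (x + d))) -opprD subrK.
have g'le : g' <= M / 2 * enorm d ^+ 2 + (enorm w + m / 3 * s * enorm d).
  rewrite /g' g'E; apply: le_trans (enorm_triangle _ _) _; apply: lerD => //.
  apply: le_trans (enorm_triangle _ _) _.
  by rewrite enormN enormZ ger0_norm// mulr_ge0// divr_ge0// ltW.
rewrite AE -sqr_enorm in q0; rewrite AE in wq.
have D0 := enorm_ge0 d; have W0 := enorm_ge0 w.
have Ds : 3 * m * enorm d <= s.
  have := dfeas; rewrite mulrC ler_pdivlMr; last lra.
  by rewrite mulrC.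
have D1 : enorm d < (3 * m)^-1 * s \/ 3 * m * enorm d = s.
  have := dfeas; rewrite le_eqVlt => /orP[/eqP ->|->]; [right|by left].
  by rewrite mulVKf// gt_eqF//; lra.
have W1 : enorm d < (3 * m)^-1 * s -> enorm w = 0 by move/wint ->; rewrite enorm0.
have W2 : s * enorm w <= 3 * m * - (2 * (2^-1 * (dotp (d *m hessian f x) d +
    m / 3 * s * enorm d ^+ 2) + dotp (gradient f x) d)).
  rewrite -ler_pdivrMl; last lra.
  by rewrite mulrA; apply: le_trans wq _; rewrite /= sqr_enorm; lra.
set D := enorm d in T W2 q0 D0 Ds D1 W1 g'le.
set W := enorm w in W0 W1 W2 g'le.
move: T W2 q0; move: (f x) (f (x + d)) (dotp (gradient f x) d)
  (dotp (d *m hessian f x) d) => p p' a h T W2 q0.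
clearbody D W g'; move: T g'le; rewrite sg mM => T g'le.
have mD0 : 0 <= m * D ^+ 2 by rewrite mulr_ge0 ?sqr_ge0 ?ltW.
(* The feasibility bound 3 m D <= s absorbs the cubic remainder m^2 D^3 / 6 into
   a third of the regularization gain m s D^2 / 6. *)
have cub : (3 * m * D) * (m * D ^+ 2) <= s * (m * D ^+ 2) by rewrite ler_wpM2r.
have smD0 : 0 <= s * (m * D ^+ 2) by rewrite mulr_ge0.
have dec : - (2^-1 * (h + m / 3 * s * D ^+ 2) + a) + s * (m * D ^+ 2) / 9 <= p - p'.
  by move: T cub; rewrite !(exprS, expr0); lra.
have g'W : g' <= s ^+ 2 / 6 + W.
  have E0 : 0 <= m * D by rewrite mulr_ge0// ltW.
  have : (m * D) ^+ 2 <= (s / 3) ^+ 2 by rewrite ler_pXn2r ?nnegrE//; lra.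
  have : s * (m * D) <= s * (s / 3) by rewrite ler_wpM2l//; lra.
  by move: g'le; rewrite !(exprS, expr0); lra.
split; first by lra.
case: D1 => [/W1 WE|sE]; [left|right].
  by move: g'W; rewrite WE; lra.
have mdec := ler_wpM2l (ltW m0) dec.
have sg'W := ler_wpM2l s0 g'W.
have mq := mulr_ge0_le0 (ltW m0) q0.
have msmD := mulr_ge0 (ltW m0) smD0.
split; last by move: sg'W W2 mdec msmD; lra.
by move: mdec mq; rewrite -sE; lra.
Qed.
End Step.

(** * Counting the steps *)

Lemma expR1_le4 {R : realType} : expR 1 <= 4 :> R.
Proof.
have h2 : expR 2^-1 <= 2 :> R.
  have := expR_ge1Dx (- 2^-1 : R); rewrite expRN => h.
  rewrite -lef_pV2 ?posrE ?expR_gt0//; lra.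
have -> : 1 = 2^-1 + 2^-1 :> R by lra.
rewrite expRD; have := ler_pM (expR_ge0 _) (expR_ge0 _) h2 h2; lra.
Qed.

Section Counting.
(* phi k, g k stand for the function value and the gradient norm at the k-th
   iterate, m for sqrt M; gapG and decG are the two ways in which G controls the
   gradient after a boundary step. *)
Context {R : realType} (phi g : nat -> R) (m gap eps G : R).
Context (m0 : 0 < m) (eps0 : 0 < eps) (epsG : eps <= G) (g0G : g 0 <= G).
Context (gapG : 12 * m * gap <= Num.sqrt eps * G).
Context (decG : forall a, 0 <= a -> a * Num.sqrt a <= 81 * m * gap -> 6 * a <= G).
Context (phi_gap : forall k, phi 0 - phi k <= gap).
Context (step : forall k, eps < g k ->
  phi k.+1 <= phi k /\
  (g k.+1 <= g k / 6 \/
   g k * Num.sqrt (g k) <= 81 * m * (phi k - phi k.+1) /\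
   Num.sqrt (g k) * g k.+1 <=
     Num.sqrt (g k) * (g k / 6) + 6 * m * (phi k - phi k.+1))).

Let e32 := eps * Num.sqrt eps.
Let L := ln (G / eps).

(** The potential on the right grows by at least 1 at every step.  The coefficient
L + 1 pays for the largest possible drop L of the logarithmic term in a
boundary step, plus the step itself.  The bound g k <= G is carried along
because it keeps the logarithmic term nonnegative. *)
Lemma potential_ge k : (forall j, (j <= k)%N -> eps < g j) ->
  [/\ phi k <= phi 0, g k <= G &
   k%:R <= 81 * m * (phi 0 - phi k) / e32 * (L + 1) + (ln G - ln (g k))].
Proof.
have G0 : 0 < G by apply: lt_le_trans epsG.
have se0 : 0 < Num.sqrt eps by rewrite sqrtr_gt0.
have e320 : 0 < e32 by rewrite mulr_gt0.
have LE : L = ln G - ln eps by rewrite /L ln_div.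
have L0 : 0 <= L by rewrite LE subr_ge0 ler_ln.
have L10 : 0 <= L + 1 by lra.
elim: k => [|k IH] H.
  split=> //; rewrite subrr mulr0 mul0r mul0r add0r subr_ge0 ler_ln ?posrE//.
  exact: lt_trans (H 0%N _).
have [IH1 IH2 IH3] := IH (fun j jk => H j (leqW jk)).
have egk : eps < g k by apply: H.
have egk1 : eps < g k.+1 by apply: H.
have gk0 : 0 < g k by apply: lt_trans egk.
have gk10 : 0 < g k.+1 by apply: lt_trans egk1.
have [phile dich] := step k egk.
have phi0k : phi 0 - phi k.+1 <= gap by exact: phi_gap.
have D0 : 0 <= 81 * m * (phi k - phi k.+1) / e32.
  by rewrite divr_ge0 ?(ltW e320)// mulr_ge0// ?subr_ge0// mulr_ge0// ltW.
have DE : 81 * m * (phi 0 - phi k.+1) / e32 =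
    81 * m * (phi 0 - phi k) / e32 + 81 * m * (phi k - phi k.+1) / e32.
  by rewrite -mulrDl -mulrDr addrA subrK.
rewrite DE -natr1.
case: dich => [lin|[dec1 dec2]].
  have lnle : ln (g k.+1) + 1 <= ln (g k).
    rewrite -[X in _ + X]expRK -lnM ?posrE ?expR_gt0// ler_ln ?posrE ?mulr_gt0 ?expR_gt0//.
    have := ler_wpM2l (ltW gk10) (@expR1_le4 R); lra.
  split; [lra|lra|].
  by have := mulr_ge0 D0 L10; lra.
have sg : Num.sqrt eps <= Num.sqrt (g k) by rewrite ler_sqrt// ltW.
have D1 : 1 <= 81 * m * (phi k - phi k.+1) / e32.
  rewrite ler_pdivlMr// mul1r; apply: le_trans dec1.
  by rewrite ler_pM// ltW.
have gG6 : 6 * g k <= G.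
  apply: decG; first exact: ltW.
  apply: le_trans dec1 _; rewrite ler_pM2l ?mulr_gt0//; lra.
have g1G : g k.+1 <= G.
  have s0 : 0 < Num.sqrt (g k) by rewrite sqrtr_gt0.
  rewrite -(ler_pM2l s0); apply: le_trans dec2 _.
  have a1 : 6 * m * (phi k - phi k.+1) <= Num.sqrt (g k) * G / 2.
    have : m * (phi k - phi k.+1) <= m * gap by rewrite ler_pM2l//; lra.
    have := ler_wpM2r (ltW G0) sg; move: gapG => /=; lra.
  by have := ler_wpM2l (ltW s0) gG6; lra.
split; [lra|by[]|].
have l1 : ln (g k.+1) <= ln G by rewrite ler_ln.
have l2 : ln eps < ln (g k) by rewrite ltr_ln.
by have := ler_wpM2r L10 D1; lra.
Qed.

(** The potential at any index before stationarity is at most 81 P (L + 1) + L,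
with P := m * gap / e32, and P and L are at least 1: the last nonstationary
index is at most 163 P L, and one more step is needed to reach the stationary
one. *)
Lemma first_index_le : e32 <= m * gap ->
  exists2 k, g k <= eps /\ (forall j, (j < k)%N -> eps < g j) &
  k%:R <= 164 * (m * gap / e32 * L).
Proof.
move=> e32le.
have G0 : 0 < G by apply: lt_le_trans epsG.
have se0 : 0 < Num.sqrt eps by rewrite sqrtr_gt0.
have e320 : 0 < e32 by rewrite mulr_gt0.
have P1 : 1 <= m * gap / e32 by rewrite ler_pdivlMr// mul1r.
have LE : L = ln G - ln eps by rewrite /L ln_div.
have L1 : 1 <= L.
  rewrite -[leLHS]expRK /L ler_ln ?posrE ?expR_gt0 ?divr_gt0// ler_pdivlMr//.
  rewrite -(ler_pM2l se0); apply: le_trans gapG.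
  have := ler_wpM2r (ltW e320) (@expR1_le4 R).
  by move: e32le e320; rewrite /e32 /=; lra.
have bnd k : (forall j, (j <= k)%N -> eps < g j) ->
    k.+1%:R <= 164 * (m * gap / e32 * L).
  move=> H; have [_ _ K] := potential_ge k H.
  have l2 : ln eps < ln (g k) by rewrite ltr_ln ?posrE// ?(lt_trans eps0 (H k _))// H.
  have D : 81 * m * (phi 0 - phi k) / e32 <= 81 * (m * gap / e32).
    rewrite -!mulrA ler_pM2l// mulrA mulrA ler_pM2r ?invr_gt0// ler_pM2l//.
  rewrite -natr1; set P := m * gap / e32 in P1 D *.
  have := ler_wpM2r (addr_ge0 (le_trans ler01 L1) ler01) D.
  have := ler_wpM2l (le_trans ler01 P1) L1.
  have := ler_wpM2r (le_trans ler01 L1) P1; lra.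
have exk : exists k, g k <= eps.
  apply/not_existsP => noex.
  have big k : eps < g k by rewrite ltNge; apply/negP/noex.
  have := bnd (Num.truncn (164 * (m * gap / e32 * L))) (fun j _ => big j).
  by rewrite leNgt truncnS_gt.
have [k gk kmin] := find_ex_minn exk.
exists k; first split => // j jk.
  by rewrite ltNge; apply/negP => /kmin; rewrite leqNgt jk.
case: k gk kmin => [|k] gk kmin.
  rewrite mulr_ge0// mulr_ge0//; lra.
apply: bnd => j jk; rewrite ltNge; apply/negP => /kmin.
by rewrite leqNgt ltnS jk.
Qed.
End Counting.

(** * The complexity bound *)

Lemma powR32 {R : realType} (a : R) : 0 <= a -> a `^ (3 / 2) = a * Num.sqrt a.
Proof.
move=> a0; have -> : 3 / 2 = 1 + 2^-1 :> R by lra.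
rewrite powRD ?powRr1 ?powR12_sqrt//.
by apply/implyP => /eqP; lra.
Qed.

Lemma powR_32_23 {R : realType} (a : R) : 0 <= a -> (a * Num.sqrt a) `^ (2 / 3) = a.
Proof.
move=> a0; rewrite -powR32// -powRrM.
have -> : 3 / 2 * (2 / 3) = 1 :> R by lra.
exact: powRr1.
Qed.

Lemma powR_23_32 {R : realType} (a : R) : 0 <= a ->
  a `^ (2 / 3) * Num.sqrt (a `^ (2 / 3)) = a.
Proof.
move=> a0; rewrite -powR32 ?powR_ge0// -powRrM.
have -> : 2 / 3 * (3 / 2) = 1 :> R by lra.
exact: powRr1.
Qed.

(** Taylor's upper bound along - t g, compared to order t. *)
Lemma gradient_at_minimum {R : realType} {n : nat} (f : 'rV[R]_n -> R) (M : R) x :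
  twice_differentiable f -> lipschitz_hessian f M -> 0 <= M ->
  (forall y, f x <= f y) -> gradient f x = 0.
Proof.
move=> f2 fM M0 xmin; set g := gradient f x.
apply/eqP; rewrite -dotp_eq0 eq_le dotp_ge0 andbT.
apply: (@le0_of_le_scaled _ _
  (2^-1 * dotp (g *m hessian f x) g + M / 6 * enorm g ^+ 3)) => t /andP[t0 t1].
have := le_trans (xmin _) (taylor_upper f M f2 fM x (- (t *: g))).
rewrite -/g enormN enormZ (ger0_norm (ltW t0)) mulNmx -scalemxAl !dotp_bilin => T.
rewrite -(ler_pM2l t0).
have : 0 <= M / 6 * enorm g ^+ 3 * t ^+ 2 * (1 - t).
  have E0 := enorm_ge0 g.
  by rewrite !mulr_ge0 ?exprn_ge0 ?(ltW t0)//; lra.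
by move: T; rewrite !(exprS, expr0); lra.
Qed.

Theorem theorem3p1 (R : realType) :
  exists2 C : R, 0 < C &
  forall (n : nat) (f : 'rV[R]_n -> R) (M : R) (x0 : 'rV[R]_n),
    twice_differentiable f ->
    has_lbound (range f) ->
    0 < M ->
    lipschitz_hessian f M ->
    \forall eps \near 0^'+,
      forall x : nat -> 'rV[R]_n,
        utr_simple_iterates f M x0 x ->
        exists2 k : nat,
          first_stationary f x eps k &
          k%:R <= C * (Num.sqrt M * init_gap f x0 * eps `^ (- (3 / 2))
                       * ln (utr_G f M x0 eps / eps)).
Proof.
exists 164; first by [].
move=> n f M x0 f2 flb M0 fM.
have m0 : 0 < Num.sqrt M by rewrite sqrtr_gt0.
have fge y : inf (range f) <= f y by apply: ge_inf => //; exists y.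
have gap0 : 0 <= init_gap f x0 by rewrite subr_ge0.
have [gapE|gapN0] := eqVneq (init_gap f x0) 0.
  near=> eps => x [xx0 _].
  have eps0 : 0 < eps by near: eps; exact: nbhs_right_gt.
  exists 0%N.
    split => //; rewrite xx0 (gradient_at_minimum f M) ?enorm0 ?(ltW M0)//.
    by move=> y; apply: le_trans (fge y); move: gapE; rewrite /init_gap; lra.
  by rewrite gapE mulr0 !mul0r mulr0.
have mgap : 0 < Num.sqrt M * init_gap f x0.
  by rewrite mulr_gt0// lt0r gapN0.
near=> eps => x [xx0 xS].
have eps0 : 0 < eps by near: eps; exact: nbhs_right_gt.
have epsle : eps <= (Num.sqrt M * init_gap f x0) `^ (2 / 3).
  by near: eps; apply: nbhs_right_le; exact: powR_gt0.
have se0 : 0 < Num.sqrt eps by rewrite sqrtr_gt0.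
(* That is, P >= 1, and then L >= 1 as well because G / eps >= 12 P. *)
have e32 : eps * Num.sqrt eps <= Num.sqrt M * init_gap f x0.
  rewrite -[leRHS]powR_23_32 ?(ltW mgap)//.
  exact: ler_pM (ltW eps0) (ltW se0) epsle (ler_wsqrtr epsle).
set G := utr_G f M x0 eps.
have G1 a : 0 <= a -> a * Num.sqrt a <= 81 * Num.sqrt M * init_gap f x0 -> 6 * a <= G.
  move=> a0 aD; rewrite /G /utr_G /utr_xi /utr_kappa !invrK le_max; apply/orP; left.
  rewrite ler_pM2l// -[leLHS]powR_32_23//.
  apply: ge0_ler_powR; rewrite ?nnegrE ?mulr_ge0 ?sqrtr_ge0//.
  by move: aD; lra.
have G2 : enorm (gradient f (x 0%N)) <= G.
  by rewrite xx0 /G /utr_G !le_max lexx !orbT.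
have G3 : 12 * Num.sqrt M * init_gap f x0 <= Num.sqrt eps * G.
  rewrite -ler_pdivrMl// /G /utr_G !le_max; apply/orP; right; apply/orP; right.
  by rewrite mulrC mulrAC.
have epsG : eps <= G by rewrite -(ler_pM2l se0); lra.
have [||k [k1 k2] kle] := @first_index_le R (f \o x) (fun k => enorm (gradient f (x k)))
  (Num.sqrt M) (init_gap f x0) eps G m0 eps0 epsG G2 G3 G1 _ _ e32.
- by move=> k; rewrite /= xx0 /init_gap; have := fge (x k); lra.
- move=> k _; have [d dS xd] := xS k; rewrite /= xd.
  exact: utr_step f M f2 fM M0 _ _ dS.
exists k; first by split.
by rewrite powRN powR32// ltW.
Unshelve. all: by end_near. Qed.
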